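(* Let $K$ be an orientable, closed, connected, (polygonally) cellulated surface embedded in $\mathbb{R}^3$, and let $K'$ be a punctured cellulated surface obtained by removing a face from $K$. Then $K'$ admits a Pfaffian orientation.
   Context: A (polygonally) cellulated surface is a surface with a polygonal cell decomposition; its $2$-cells are called faces, its $1$-cells edges and its $0$-cells vertices, and $\mathcal{F}(K)$, $\mathcal{E}(K)$, $\mathcal{V}(K)$ denote the sets of faces, edges and vertices of $K$. We write $e\subseteq f$ if the edge $e$ is contained in the face $f$ (i.e. is an edge of $f$). The cellulated surface $K$ has the following properties: (a) each edge of $K$ is contained in exactly two faces of $K$; (b) any two faces $f_0,f_n$ are joined by a sequence $f_0,e_0,f_1,\dots,e_{n-1},f_n$ of faces and edges with $f_i\supseteq e_i\subseteq f_{i+1}$ for all $i$. Each face is given the orientation determined by the right-hand rule along its outward normal vector; thus the two faces containing a given edge induce opposite orientations on that edge. The punctured cellulated surface $K'$ is obtained from $K$ by removing one face (the $2$-cell only; all edges and vertices are kept), so $\mathcal{F}(K')=\mathcal{F}(K)\setminus\{f_0\}$ for some $f_0 \in \mathcal{F}(K)$, $\mathcal{E}(K')=\mathcal{E}(K)$ and $\mathcal{V}(K')=\mathcal{V}(K)$. A Pfaffian orientation on $K'$ is an assignment of an orientation (direction) to each edge of $K'$ such that for every face $f$ of $K'$, the number of edges $e$ of $f$ whose orientation is opposite to the orientation induced by $f$ on $e$ is odd. *)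

(* Defs.v *)
(* MathComp-Analysis *)
From HB Require Import structures.
From mathcomp Require Import all_boot all_order all_algebra.
From mathcomp Require Import all_classical all_reals all_analysis.

Set Implicit Arguments.
Unset Strict Implicit.
Unset Printing Implicit Defensive.

Import Order.TTheory GRing.Theory Num.Theory.
Import numFieldNormedType.Exports.

Local Open Scope classical_set_scope.
Local Open Scope ring_scope.

Definition homeomorphic (T U : topologicalType) (A : set T) (B : set U) : Prop :=
  exists (f : T -> U) (g : U -> T),
    [/\ {within A, continuous f}, {within B, continuous g},
        f @` A `<=` B, g @` B `<=` A &
        (forall x, A x -> g (f x) = x) /\ (forall y, B y -> f (g y) = y)].

Definition open_disk (R : realType) : set (R * R) :=
  [set p | p.1 ^+ 2 + p.2 ^+ 2 < 1].

Definition closed_disk (R : realType) : set (R * R) :=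
  [set p | p.1 ^+ 2 + p.2 ^+ 2 <= 1].

Definition circle (R : realType) (t : R) : R * R :=
  (cos (2 * pi * t), sin (2 * pi * t)).

(* "Closed" in the sense of manifolds: compact and without boundary. *)
Definition closed_surface (R : realType) (S : set 'rV[R]_3) : Prop :=
  compact S /\
  forall x, S x -> exists U : set 'rV[R]_3,
    [/\ open U, U x & homeomorphic (S `&` U) (@open_disk R)].

(* A decomposition of S into finitely many open cells, given by characteristic
   maps.  The boundary circle of the disk parametrizing a face f is cut into
   [nsides f] equal arcs, and the i-th arc is mapped, counterclockwise, onto the
   edge [(side f i).1], traversed in the direction of its characteristic map if
   [(side f i).2] is true and against it otherwise.  Matching the
   parametrizations exactly is no restriction, since a homeomorphism of the
   boundary circle extends to the disk.  On a surface, [side_inj] is forced by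
   [edge_two_faces], an edge having only two sides. *)
Record cellulation (R : realType) (S : set 'rV[R]_3) := Cellulation {
  vertex : finType;
  edge : finType;
  face : finType;
  vpos : vertex -> 'rV[R]_3;
  edge_map : edge -> R -> 'rV[R]_3;
  face_map : face -> R * R -> 'rV[R]_3;
  nsides : face -> nat;
  side : forall f : face, 'I_(nsides f) -> edge * bool;

  edge_map_continuous : forall e, {within `[0, 1], continuous (edge_map e)};
  edge_map_ends : forall e, range vpos (edge_map e 0) /\ range vpos (edge_map e 1);
  face_map_continuous : forall f, {within @closed_disk R, continuous (face_map f)};
  nsides_gt0 : forall f, (0 < nsides f)%N;
  face_map_side : forall (f : face) (i : 'I_(nsides f)) (s : R), 0 <= s <= 1 ->
    face_map f (circle ((i%:R + s) / (nsides f)%:R)) =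
    edge_map (side i).1 (if (side i).2 then s else 1 - s);
  side_inj : forall f : face, injective (fun i : 'I_(nsides f) => (side i).1);

  cells_cover : S = range vpos
    `|` \bigcup_(e in @setT edge) (edge_map e @` `]0, 1[)
    `|` \bigcup_(f in @setT face) (face_map f @` @open_disk R);
  vpos_inj : injective vpos;
  edge_map_inj : forall e e' (s s' : R), 0 < s < 1 -> 0 < s' < 1 ->
    edge_map e s = edge_map e' s' -> e = e' /\ s = s';
  face_map_inj : forall f f' p p', @open_disk R p -> @open_disk R p' ->
    face_map f p = face_map f' p' -> f = f' /\ p = p';
  vertex_edge_disjoint : forall v e (s : R), 0 < s < 1 -> vpos v <> edge_map e s;
  vertex_face_disjoint : forall v f p, @open_disk R p -> vpos v <> face_map f p;
  edge_face_disjoint : forall e (s : R) f p, 0 < s < 1 -> @open_disk R p ->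
    edge_map e s <> face_map f p;

  edge_two_faces : forall e,
    #|[set f : face | [exists i, (@side f i).1 == e]]%SET| = 2%N;
  faces_linked : forall f f' : face,
    connect (fun g h : face =>
      [exists e, [exists i, (@side g i).1 == e] && [exists j, (@side h j).1 == e]])
      f f'
}.

Definition edge_of (R : realType) (S : set 'rV[R]_3) (K : cellulation S)
    (e : edge K) (f : face K) : bool :=
  [exists i, (@side _ _ K f i).1 == e].

(* The orientation of f is encoded by [o f], which is true when f carries the
   orientation of the disk transported by its characteristic map, and the
   direction of an edge by a boolean, true being the direction of [edge_map].
   The value is meaningful only when e is an edge of f. *)
Definition induced_dir (R : realType) (S : set 'rV[R]_3) (K : cellulation S)
    (o : face K -> bool) (f : face K) (e : edge K) : bool :=
  [exists i, @side _ _ K f i == (e, true)] == o f.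

(* Coherent orientations of the faces, i.e. orientations of the surface.  When
   the surface is connected there are two of them, given by the right-hand rule
   along the outward and along the inward normal. *)
Definition coherent (R : realType) (S : set 'rV[R]_3) (K : cellulation S)
    (o : face K -> bool) : Prop :=
  forall e f g, f != g -> edge_of e f -> edge_of e g ->
    induced_dir o f e = ~~ induced_dir o g e.

Definition orientable (R : realType) (S : set 'rV[R]_3) (K : cellulation S) : Prop :=
  exists o : face K -> bool, coherent o.

Definition punctured_faces (R : realType) (S : set 'rV[R]_3) (K : cellulation S)
    (f0 : face K) : {set face K} := [set~ f0]%SET.

(* F is the set of faces that have been kept; all edges are. *)
Definition pfaffian_orientation (R : realType) (S : set 'rV[R]_3)
    (K : cellulation S) (o : face K -> bool) (F : {set face K})
    (w : edge K -> bool) : Prop :=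
  forall f, f \in F ->
    odd #|[set e : edge K | edge_of e f & w e != induced_dir o f e]%SET|.

(* Main.v *)
Require Import Defs.
From mathcomp Require Import all_boot all_order all_algebra.
From mathcomp Require Import all_classical all_reals all_analysis.
Import Order.TTheory GRing.Theory Num.Theory.
Import numFieldNormedType.Exports.
Local Open Scope classical_set_scope.
Local Open Scope ring_scope.

(** Read modulo 2, with booleans under [addb] as the field of two elements, a
    Pfaffian orientation is a solution [w] of a linear system with one equation
    per face: the sum over the edges [e] of [f] of [w e] must be 1 plus the sum
    over the same edges of the directions that [f] induces.

    The linear map that sends [w] to its sums around the faces is the boundary
    map of the dual graph, whose vertices are the faces and whose edges are the
    edges of the surface.  Since the dual graph is connected, every pair
    [{f, f0}] is a boundary, namely that of a dual path from [f] to [f0]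
    ([boundary_of_dual_path]).  These pairs generate all sets of faces up to
    [f0], so any right-hand side can be attained at every face but [f0]
    ([boundary_surj_off_face]).  This is why one face has to be removed: the
    sums around all the faces add up to zero, each edge being counted twice, so
    the equation at the last face cannot be prescribed. *)

(** The edges with [x e = true] form a chain of the dual graph, in which [e]
    joins the two faces containing it. *)
Definition boundary (E F : finType) (inc : E -> F -> bool)
    (x : E -> bool) (f : F) : bool :=
  \big[addb/false]_(e | inc e f) x e.

Lemma boundary_addb (E F : finType) (inc : E -> F -> bool) (x y : E -> bool)
    (f : F) :
  boundary E F inc (fun e => x e (+) y e) f =
  boundary E F inc x f (+) boundary E F inc y f.
Proof. exact: big_split. Qed.

Lemma boundary_pred1 (E F : finType) (inc : E -> F -> bool) (e : E) (f : F) :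
  boundary E F inc (pred1 e) f = inc e f.
Proof.
rewrite /boundary; case: (boolP (inc e f)) => [ef|nef].
- by rewrite (bigD1 e) //= eqxx big1 // => e' /andP[_ /negbTE].
- by rewrite big1 // => e' e'f /=; apply: contraNF nef => /eqP <-.
Qed.

Lemma boundary_dual_edge (E F : finType) (inc : E -> F -> bool) (e : E)
    (g h : F) :
  #|[set f | inc e f]%SET| = 2%N -> inc e g -> inc e h -> g != h ->
  forall f, boundary E F inc (pred1 e) f = (f == g) (+) (f == h).
Proof.
move=> two_e eg eh gh f; rewrite boundary_pred1.
have /eqP/setP/(_ f) : [set g; h]%SET == [set f | inc e f]%SET.
  rewrite eqEcard two_e cards2 gh leqnn andbT.
  by apply/fintype.subsetP => k; rewrite !inE => /orP[] /eqP ->.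
rewrite !inE => <-.
by case: (eqVneq f g) => // ->; rewrite (negbTE gh).
Qed.

(** The chain is the sum of the edges crossed by a path from [f0] to [f]; the
    contributions of the intermediate faces cancel.  A step of the path may
    stay at the same face, and then no edge is added. *)
Lemma boundary_of_dual_path (E F : finType) (inc : E -> F -> bool) (f0 f : F) :
  (forall e, #|[set g | inc e g]%SET| = 2%N) ->
  connect (fun g h => [exists e, inc e g && inc e h]) f0 f ->
  exists x : E -> bool,
    forall g, boundary E F inc x g = (g == f) (+) (g == f0).
Proof.
move=> two_faces /connectP[p]; elim/last_ind: p f => [|p h IHp] f /=.
  move=> _ ->; exists xpred0 => g.
  by rewrite addbb /boundary big1.
rewrite rcons_path last_rcons => /andP[/IHp/(_ erefl)[x xE]].
move=> /existsP[e /andP[e_last eh]] ->.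
case: (eqVneq (last f0 p) h) => [<-|neq]; first by exists x.
exists (fun e' => x e' (+) pred1 e e') => g.
rewrite boundary_addb xE (@boundary_dual_edge _ _ _ _ _ _ (two_faces e) e_last eh neq).
by rewrite addbAC addbA addbb addFb.
Qed.

(** Superpose, over the faces [f] with [t f = true], a dual path from [f0] to
    [f]: away from [f0], only the far end of each path is visible. *)
Lemma boundary_surj_off_face (E F : finType) (inc : E -> F -> bool) (f0 : F)
    (t : F -> bool) :
  (forall e, #|[set f | inc e f]%SET| = 2%N) ->
  (forall f, connect (fun g h => [exists e, inc e g && inc e h]) f0 f) ->
  exists x : E -> bool, forall f, f != f0 -> boundary E F inc x f = t f.
Proof.
move=> two_faces linked.
have [c cE] := choice (fun f =>
  @boundary_of_dual_path E F inc f0 f two_faces (linked f)).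
exists (fun e => \big[addb/false]_(f | t f) c f e) => g g_f0.
rewrite /boundary exchange_big /=.
under eq_bigr => f _ do rewrite -/(boundary E F inc (c f) g) cE (negbTE g_f0) addbF.
case: (boolP (t g)) => [tg|ntg].
- rewrite (bigD1 g) //= eqxx big1 // => f /andP[_].
  by rewrite eq_sym => /negbTE.
- by rewrite big1 // => f tf; apply: contraNF ntg => /eqP ->.
Qed.

Lemma odd_card_boundary (E F : finType) (inc : E -> F -> bool) (x : E -> bool)
    (f : F) :
  odd #|[set e | inc e f & x e]%SET| = boundary E F inc x f.
Proof.
rewrite -sum1dep_card (big_morph odd oddD (erefl _)) big_mkcondr /=.
by apply: eq_bigr => e _; case: (x e).
Qed.

Theorem theorem2 (R : realType) (S : set 'rV[R]_3)
  (closedS : closed_surface S) (connectedS : connected S)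
  (K : cellulation S) (orientableK : orientable K)
  (o : face K -> bool) (coherent_o : coherent o) (f0 : face K) :
  exists w : edge K -> bool,
    pfaffian_orientation o (punctured_faces f0) w.
Proof.
have [w wE] := @boundary_surj_off_face _ _ (@edge_of R S K) f0
  (fun f => ~~ boundary _ _ (@edge_of R S K) (induced_dir o f) f)
  (@edge_two_faces R S K) (@faces_linked R S K f0).
exists w => f; rewrite !inE => f_f0.
rewrite (odd_card_boundary _ _ (@edge_of R S K) (fun e => w e != induced_dir o f e)).
have -> : (fun e => w e != induced_dir o f e) =
          (fun e => w e (+) induced_dir o f e).
  by apply/funext => e; rewrite negb_eqb.
by rewrite boundary_addb wE // addNb addbb.
Qed.
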